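(* Let $\mathcal{M}$ be a matroid with rank function $r$. If $\mathcal{M}=\mathcal{M}_1\oplus\cdots\oplus\mathcal{M}_k$ is a direct sum of matroids, where each $\mathcal{M}_i$ has rank function $r_i$, then $\mathcal{CG}(r)=\min_{1\le i\le k}\mathcal{CG}(r_i)$.
   Context: Matroids are on finite ground sets. For $f\colon 2^E\to\mathbb{R}_+$ ($E$ finite) and $x\in[0,1]^E$, the multilinear extension is $F(x)=\sum_{S\subseteq E}f(S)\prod_{i\in S}x_i\prod_{i\notin S}(1-x_i)$, and the concave extension is $\hat f(x)=\max\{\sum_{S\subseteq E}\lambda_S f(S): \sum_{S\ni i}\lambda_S=x_i\ \forall i\in E,\ \sum_{S\subseteq E}\lambda_S=1,\ \lambda\ge0\}$. The correlation gap of $f$ is $\mathcal{CG}(f)=\inf_{x\in[0,1]^E}F(x)/\hat f(x)$, with the convention $0/0=1$. For each $i$, $r_i$ is regarded as a function on the subsets of the ground set of $\mathcal{M}_i$. *)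

(* Defs.v *)
From mathcomp Require Import all_boot all_order all_algebra.
From mathcomp Require Import all_classical all_reals all_analysis.

Set Implicit Arguments.
Unset Strict Implicit.
Unset Printing Implicit Defensive.

Import Order.TTheory GRing.Theory Num.Theory numFieldNormedType.Exports.

Local Open Scope classical_set_scope.
Local Open Scope ring_scope.

(* A matroid whose ground set is a subset of a fixed finite universe T, so that
   the summands of a direct sum live in the same type. *)
Record matroid (T : finType) := Matroid {
  ground : {set T};
  indep : {set {set T}};
  indep_ground : forall I, I \in indep -> I \subset ground;
  indep_set0 : finset.set0 \in indep;
  indep_sub : forall I J : {set T}, J \in indep -> I \subset J -> I \in indep;
  indep_aug : forall I J : {set T}, I \in indep -> J \in indep ->
    (#|I| < #|J|)%N ->
    exists2 e, e \in J :\: I & finset.setU [set e]%SET I \in indep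
}.

Section Matroid.
Variable T : finType.

Definition rank (M : matroid T) (S : {set T}) : nat :=
  \max_(I in indep M | I \subset S) #|I|.

(* M = M_1 (+) ... (+) M_k: the ground sets are disjoint with union that of M,
   and the independent sets are the unions I_1 U ... U I_k, I_i in indep M_i. *)
Definition is_direct_sum (k : nat) (M : matroid T) (Ms : 'I_k -> matroid T) :=
  [/\ forall i j, i != j -> ground (Ms i) :&: ground (Ms j) = finset.set0,
      ground M = (\bigcup_i ground (Ms i))%SET
    & forall S : {set T}, S \in indep M <->
        exists2 I : 'I_k -> {set T},
          forall i, I i \in indep (Ms i) & S = (\bigcup_i I i)%SET].

End Matroid.

(* Functions f : 2^E -> R_+ and points x of [0,1]^E, E a subset of T, are
   represented by total functions on {set T} and T. Only the values of f at
   subsets of E and those of x at elements of E are used. *)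
Section CorrelationGap.
Variables (R : realType) (T : finType) (E : {set T}) (f : {set T} -> R).

Definition cube : set (T -> R) := [set x | forall i, i \in E -> 0 <= x i <= 1].

Definition multilinear_ext (x : T -> R) : R :=
  \sum_(S : {set T} | S \subset E)
    f S * (\prod_(i in S) x i) * (\prod_(i in E :\: S) (1 - x i)).

Definition decomposition (x : T -> R) : set ({set T} -> R) :=
  [set l | [/\ forall i, i \in E ->
                 \sum_(S : {set T} | (S \subset E) && (i \in S)) l S = x i,
               \sum_(S : {set T} | S \subset E) l S = 1
             & forall S : {set T}, S \subset E -> 0 <= l S]].

Definition decomposition_value (l : {set T} -> R) : R :=
  \sum_(S : {set T} | S \subset E) l S * f S.

Definition concave_ext (x : T -> R) : R :=
  sup [set decomposition_value l | l in decomposition x].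

(* The supremum in concave_ext is a maximum, as required. *)
Lemma decomposition_neq0 (x : T -> R) : cube x -> decomposition x !=set0.
Proof.
move=> x01.
pose F i := if i \in E then x i else 0.
pose G i := if i \in E then 1 - x i else 1.
pose L (F G : T -> R) (S : {set T}) := \prod_i (if i \in S then F i else G i).
have L0 G' (S : {set T}) : ~~ (S \subset E) -> L F G' S = 0.
  move=> /subsetPn[i iS iE]; rewrite /L (bigD1 i)//= iS /F (negbTE iE).
  by rewrite mul0r.
have sumL G' : \sum_(S : {set T} | S \subset E) L F G' S =
    \prod_i (F i + G' i).
  transitivity (\sum_(S : {set T}) L F G' S); last by rewrite bigA_distr.
  rewrite [RHS](bigID (fun S : {set T} => S \subset E))/=.
  by rewrite [X in _ = _ + X]big1 ?addr0// => S; exact: L0.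
exists (L F G); split.
- move=> j jE; pose G' i := if i == j then 0 else G i.
  transitivity (\sum_(S : {set T} | S \subset E) L F G' S).
    rewrite [RHS](bigID (fun S : {set T} => j \in S))/= [X in _ + X]big1 ?addr0.
      apply: eq_bigr => S /andP[_ jS]; apply: eq_bigr => i _.
      by rewrite /G'; case: (eqVneq i j) => [->|//]; rewrite jS.
    move=> S /andP[_ jS]; rewrite /L (bigD1 j)//= (negbTE jS) /G' eqxx.
    by rewrite mul0r.
  rewrite sumL (bigD1 j)//= big1 => [|i ij].
    by rewrite /F /G' jE eqxx addr0 mulr1.
  by rewrite /G' (negbTE ij) /F /G; case: ifP => _; rewrite ?add0r// addrC subrK.
- rewrite sumL big1// => i _; rewrite /F /G.
  by case: ifP => _; rewrite ?add0r// addrC subrK.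
- move=> S _; apply: prodr_ge0 => i _; rewrite /F /G.
  have := x01 i; case: ifP => iE; case: ifP => // _ /(_ isT) /andP[x0 x1] //.
  by rewrite subr_ge0.
Qed.

Lemma concave_ext_max (x : T -> R) : cube x ->
  (exists2 l, decomposition x l & concave_ext x = decomposition_value l) /\
  (forall l, decomposition x l -> decomposition_value l <= concave_ext x).
Proof.
move=> /decomposition_neq0 [l0 l0x].
pose V : topologicalType := {ptws {set T} -> R}.
have eval_cont (S : {set T}) :
    continuous ((fun l : {set T} -> R => l S) : V -> R).
  by move=> l; exact: (@proj_continuous _ (fun _ : {set T} => R) S l).
have term_cont (c : {set T} -> R) (S : {set T}) :
    continuous ((fun l : {set T} -> R => l S * c S) : V -> R).
  move=> l; apply: (@continuousM R V) => //; first exact: eval_cont.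
  exact: cst_continuous.
have sum_cont (P : pred {set T}) (c : {set T} -> R) : continuous
    ((fun l : {set T} -> R => \sum_(S | P S) l S * c S) : V -> R).
  apply: (continuous_big (U := R)) => [|S _]; first exact: add_continuous.
  exact: term_cont.
have sum_closed (P : pred {set T}) (a : R) : closed
    ([set l : {set T} -> R | \sum_(S | P S) l S * 1 = a] : set V).
  apply: (@preimage_closed V R
    (fun l : {set T} -> R => \sum_(S | P S) l S * 1) [set y | y = a]).
    by move=> l _; exact: (sum_cont P (fun=> 1)).
  exact: closed_eq.
pose trunc (l : {set T} -> R) (S : {set T}) := if S \subset E then l S else 0.
have truncE (P : pred {set T}) l :
    \sum_(S : {set T} | (S \subset E) && P S) trunc l S =
    \sum_(S : {set T} | (S \subset E) && P S) l S.
  by apply: eq_bigr => S /andP[SE _]; rewrite /trunc SE.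
have trunc_value l : decomposition_value (trunc l) = decomposition_value l.
  by apply: eq_bigr => S SE; rewrite /trunc SE.
have trunc_dec l : decomposition x l -> decomposition x (trunc l).
  case=> lx l1 l_ge0; split=> [i iE||S SE].
  - by rewrite truncE lx.
  - by rewrite -l1; apply: eq_bigr => S SE; rewrite /trunc SE.
  - by rewrite /trunc SE l_ge0.
pose K : set V := [set l : {set T} -> R |
    forall S : {set T}, `[0, 1]%classic (l S)] `&`
  \bigcap_(i in [set i | i \in E]) [set l : {set T} -> R |
    \sum_(S : {set T} | (S \subset E) && (i \in S)) l S * 1 = x i] `&`
  [set l : {set T} -> R | \sum_(S : {set T} | S \subset E) l S * 1 = 1].
have K_compact : compact K.
  apply: compact_closedI; last first.
    exact: sum_closed.
  apply: compact_closedI; last first.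
    by apply: closed_bigI => i _; exact: sum_closed.
  apply: (@tychonoff _ (fun _ : {set T} => R) (fun=> `[0, 1]%classic)) => S.
  exact: segment_compact.
have dec_K l : decomposition x l -> K (trunc l).
  move=> lx; have [tx t1 t_ge0] := trunc_dec _ lx; split; first split.
  - move=> S; rewrite /= in_itv/= /trunc; case: ifPn => [SE|_]; last first.
      by rewrite lexx ler01.
    have [_ l1 l_ge0] := lx; rewrite l_ge0//= -l1 (bigD1 S)//= lerDl.
    by apply: sumr_ge0 => S' /andP[S'E _]; exact: l_ge0.
  - by move=> i /= iE; under eq_bigr do rewrite mulr1; rewrite tx.
  - by rewrite /=; under eq_bigr do rewrite mulr1.
have K_dec l : K l -> decomposition x l.
  move=> [[l01 lx] l1]; split=> [i iE||S _].
  - by rewrite -(lx i iE); apply: eq_bigr => S _; rewrite mulr1.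
  - by rewrite -[RHS]l1; apply: eq_bigr => S _; rewrite mulr1.
  - by have := l01 S; rewrite /= in_itv/= => /andP[].
have [||m /set_mem mK m_max] :=
    @compact_EVT_max V R decomposition_value K _ K_compact.
- by exists (trunc l0); exact: dec_K.
- by apply: continuous_subspaceT => l; exact: (sum_cont _ f).
have m_ub l : decomposition x l -> decomposition_value l <= decomposition_value m.
  by move=> lx; rewrite -trunc_value; apply: m_max; apply/mem_set; exact: dec_K.
have -> : concave_ext x = decomposition_value m.
  apply/eqP; rewrite eq_le ge_sup/=.
  - apply: ub_le_sup; last by exists m => //; exact: K_dec.
    by exists (decomposition_value m) => _ [l lx <-]; exact: m_ub.
  - by exists (decomposition_value l0), l0.
  - by move=> _ [l lx <-]; exact: m_ub.
by split=> //; exists m => //; exact: K_dec.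
Qed.

Definition gap_ratio (x : T -> R) : R :=
  let F := multilinear_ext x in
  let fhat := concave_ext x in
  if (F == 0) && (fhat == 0) then 1 else F / fhat.

Definition correlation_gap : R := inf [set gap_ratio x | x in cube].

End CorrelationGap.

Definition matroid_gap (R : realType) (T : finType) (M : matroid T) : R :=
  correlation_gap (ground M) (fun S => (rank M S)%:R : R).

(* Main.v *)
Require Import Defs.
From mathcomp Require Import all_boot all_order all_algebra.
From mathcomp Require Import all_classical all_reals all_analysis.

(** Write E for the disjoint union of the ground sets E_i of the summands. The
rank function of the direct sum is f(S) = sum_i f_i(S :&: E_i), with f_i the
rank function of the i-th summand, and only f_i >= 0 and f_i(set0) = 0 matter
from there on.

A decomposition of x is a probability distribution on the subsets of E whose
random set contains i with probability x_i. The multilinear extension F(x) is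
the expected value of f under one particular decomposition, in which the
elements are drawn independently; the concave extension is the largest expected
value under any decomposition. By linearity, the expected value of f is the sum
of the expected values of the f_i under the marginals on the E_i. So both
extensions are additive over the blocks:
- the independent distribution is the product of the independent distributions
  of the blocks, so these are its marginals ([multilinear_ext_blocks]);
- marginals of decompositions are decompositions, and conversely a family of
  decompositions on the blocks is the family of marginals of their product, so
  that the suprema can be attained simultaneously ([concave_ext_blocks]).

Now F / fhat = (sum_i F_i) / (sum_i fhat_i). A common lower bound m of the gaps
gives F_i >= m fhat_i for all i, hence F >= m fhat ([correlation_gap_blocks_ge]).
Conversely, a point x of the cube of E_i extended by 0 has F_j = fhat_j = 0 for
all j != i, so every ratio for f_i is also a ratio for f
([correlation_gap_blocks_le]). *)

Set Implicit Arguments.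
Unset Strict Implicit.
Unset Printing Implicit Defensive.

Import Order.TTheory GRing.Theory Num.Theory.

Local Open Scope ring_scope.

(** * Marginals of distributions on subsets *)

Section Marginal.
Variables (R : realType) (T : finType).
Implicit Types (E A B S : {set T}) (l f : {set T} -> R) (x : T -> R).

Definition marginal E A l B : R :=
  \sum_(S : {set T} | (S \subset E) && (S :&: A == B)) l S.

Lemma marginal_sum E A l f :
  \sum_(S : {set T} | S \subset E) l S * f (S :&: A) =
  decomposition_value A f (marginal E A l).
Proof.
rewrite (partition_big (fun S : {set T} => S :&: A)
  (fun B : {set T} => B \subset A)) /=; last first.
  by move=> S _; exact: finset.subsetIr.
apply: eq_bigr => B _; rewrite mulr_suml.
by apply: eq_bigr => S /andP[_ /eqP ->].
Qed.

(** With membership as a weight, the conditions defining a decomposition become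
expected values, to which [marginal_sum] applies. *)
Lemma sum_mem E l i :
  \sum_(S : {set T} | (S \subset E) && (i \in S)) l S =
  \sum_(S : {set T} | S \subset E) l S * (i \in S)%:R.
Proof.
by rewrite big_mkcondr; apply: eq_bigr => S _; case: ifP; rewrite ?mulr1 ?mulr0.
Qed.

Lemma sum_mem_marginal E A l i : i \in A ->
  \sum_(S : {set T} | (S \subset E) && (i \in S)) l S =
  \sum_(B : {set T} | (B \subset A) && (i \in B)) marginal E A l B.
Proof.
move=> iA; rewrite !sum_mem.
rewrite -[RHS]/(decomposition_value A (fun B => (i \in B)%:R) (marginal E A l)).
by rewrite -marginal_sum; apply: eq_bigr => S _; rewrite inE iA andbT.
Qed.

Lemma sum_marginal E A l :
  \sum_(B : {set T} | B \subset A) marginal E A l B =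
  \sum_(S : {set T} | S \subset E) l S.
Proof.
transitivity (decomposition_value A (fun=> 1) (marginal E A l)).
  by apply: eq_bigr => B _; rewrite mulr1.
by rewrite -marginal_sum; apply: eq_bigr => S _; rewrite mulr1.
Qed.

Lemma marginal_decomposition E A x l :
  A \subset E -> decomposition E x l -> decomposition A x (marginal E A l).
Proof.
move=> AE [lx l1 l0]; split=> [i iA||B BA].
- by rewrite -sum_mem_marginal// lx// (fintype.subsetP AE).
- by rewrite sum_marginal.
- by apply: sumr_ge0 => S /andP[SE _]; exact: l0.
Qed.

Lemma decomposition_value_ge0 E f x l :
  (forall S, 0 <= f S) -> decomposition E x l -> 0 <= decomposition_value E f l.
Proof.
by move=> f0 [_ _ l0]; apply: sumr_ge0 => S SE; rewrite mulr_ge0// l0.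
Qed.

End Marginal.

(** * Products over disjoint blocks *)

Section Blocks.
Variables (R : realType) (T I : finType) (Eb : I -> {set T}) (E : {set T}).
Hypothesis disjEb : forall i j, i != j -> Eb i :&: Eb j = finset.set0.
Hypothesis coverE : E = (\bigcup_i Eb i)%SET.
Implicit Types (B S : {set T}) (x : T -> R) (l : I -> {set T} -> R).

Lemma block_sub i : Eb i \subset E.
Proof. by rewrite coverE; exact: finset.bigcup_sup. Qed.

Lemma block_disjoint (F : I -> {set T}) : (forall i, F i \subset Eb i) ->
  forall i j, i != j -> [disjoint F i & F j].
Proof.
move=> FE i j ij; rewrite -setI_eq0 -finset.subset0 -(disjEb ij).
exact: finset.setISS.
Qed.

Lemma bigcup_setI S : S \subset E -> (\bigcup_i (S :&: Eb i))%SET = S.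
Proof.
move=> SE; apply/finset.setP => z; apply/finset.bigcupP/idP => [[i _]|zS].
  by rewrite inE => /andP[].
have := fintype.subsetP SE z zS; rewrite coverE => /finset.bigcupP[i _ zi].
by exists i => //; rewrite inE zS.
Qed.

Lemma setI_bigcup (F : I -> {set T}) j : (forall i, F i \subset Eb i) ->
  (\bigcup_i F i)%SET :&: Eb j = F j.
Proof.
move=> FE; apply/finset.setP => z; rewrite inE.
apply/andP/idP => [[/finset.bigcupP[i _ zi] zj]|zj]; last first.
  by split; [apply/finset.bigcupP; exists j|exact: (fintype.subsetP (FE j))].
have [<-//|ij] := eqVneq i j.
have /finset.setP/(_ z) := disjEb ij.
by rewrite !inE zj (fintype.subsetP (FE i)).
Qed.

(** Distributivity: choosing a subset of each block is the same as choosing a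
subset of the union. *)
Lemma sum_prod_blocks l :
  \sum_(S : {set T} | S \subset E) \prod_i l i (S :&: Eb i) =
  \prod_i \sum_(S : {set T} | S \subset Eb i) l i S.
Proof.
rewrite (bigA_distr_big_dep (fun i S => S \subset Eb i)).
rewrite (reindex_onto (fun S : {set T} => [ffun i => S :&: Eb i])
   (fun g : {ffun I -> {set T}} => \bigcup_i g i)%SET) /=; last first.
  by move=> g /familyP gE; apply/ffunP => i; rewrite ffunE setI_bigcup.
apply: eq_big => [S|S _]; last by apply: eq_bigr => i _; rewrite ffunE.
under [X in _ = _ && (X == _)]eq_bigr do rewrite ffunE.
apply/idP/andP => [SE|[_ /eqP <-]].
  split; last by rewrite bigcup_setI.
  by apply/familyP => i; rewrite ffunE; exact: finset.subsetIr.
apply/finset.bigcupsP => i _; apply: fintype.subset_trans (block_sub i).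
exact: finset.subsetIr.
Qed.

Definition product_distr l S : R := \prod_i l i (S :&: Eb i).

(** In the product of probability distributions each factor is recovered as a
marginal: all the other factors sum to 1. *)
Lemma marginal_product l j B :
  (forall i, \sum_(S : {set T} | S \subset Eb i) l i S = 1) ->
  B \subset Eb j -> marginal E (Eb j) (product_distr l) B = l j B.
Proof.
move=> l1 BE.
(* The event that the j-th trace is B is absorbed into the j-th factor, which
   makes the marginal a sum over a product of blocks again. *)
pose l' i S := if i == j then (S == B)%:R * l i S else l i S.
transitivity (\sum_(S : {set T} | S \subset E) \prod_i l' i (S :&: Eb i)).
  rewrite /marginal big_mkcondr; apply: eq_bigr => S _.
  rewrite /product_distr (bigD1 j)//= [RHS](bigD1 j)//= /l' eqxx.
  case: eqP => [_|_]; last by rewrite !mul0r.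
  by rewrite mul1r; congr (_ * _); apply: eq_bigr => i /negPf ->.
rewrite sum_prod_blocks (bigD1 j)//= [X in _ * X]big1 => [|i /negPf ij].
  rewrite mulr1 (bigD1 B)//= big1 => [|S /andP[_ /negPf SB]].
    by rewrite /l' !eqxx mul1r addr0.
  by rewrite /l' eqxx SB mul0r.
by rewrite -(l1 i); apply: eq_bigr => S _; rewrite /l' ij.
Qed.

Lemma product_decomposition x l :
  (forall i, decomposition (Eb i) x (l i)) ->
  decomposition E x (product_distr l).
Proof.
move=> lx; have l1 i : \sum_(S : {set T} | S \subset Eb i) l i S = 1.
  by have [] := lx i.
split=> [z||S SE].
- rewrite coverE => /finset.bigcupP[j _ zj].
  rewrite -coverE (sum_mem_marginal _ _ zj); have [<-// _ _] := lx j.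
  by apply: eq_bigr => B /andP[BE _]; rewrite marginal_product.
- by rewrite sum_prod_blocks big1.
- apply: prodr_ge0 => i _; have [_ _ l0] := lx i.
  by rewrite l0// finset.subsetIr.
Qed.

End Blocks.

(** * The independent distribution *)

Section Independent.
Variables (R : realType) (T : finType).
Implicit Types (E S : {set T}) (x : T -> R) (f : {set T} -> R).

Definition indep_distr E x S : R :=
  (\prod_(i in S) x i) * (\prod_(i in E :\: S) (1 - x i)).

Lemma multilinear_extE E f x :
  multilinear_ext E f x = decomposition_value E f (indep_distr E x).
Proof. by apply: eq_bigr => S _; rewrite -mulrA mulrC. Qed.

Lemma indep_distr_blocks (I : finType) (Eb : I -> {set T}) E x S :
  (forall i j, i != j -> Eb i :&: Eb j = finset.set0) ->
  E = (\bigcup_i Eb i)%SET -> S \subset E ->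
  indep_distr E x S = product_distr Eb (fun i => indep_distr (Eb i) x) S.
Proof.
move=> disjEb coverE SE.
rewrite /product_distr big_split/=; congr (_ * _).
  rewrite -{1}(bigcup_setI coverE SE) partition_disjoint_bigcup//.
  by apply: (block_disjoint disjEb) => i; exact: finset.subsetIr.
have -> : E :\: S = (\bigcup_i (Eb i :\: (S :&: Eb i)))%SET.
  apply/finset.setP => z; rewrite inE coverE.
  apply/andP/finset.bigcupP => [[zS /finset.bigcupP[i _ zi]]|[i _]].
    by exists i => //; rewrite !inE zi (negPf zS).
  rewrite !inE => /andP[zSi zi]; move: zSi; rewrite zi andbT => ->; split=> //.
  by apply/finset.bigcupP; exists i.
rewrite partition_disjoint_bigcup//.
by apply: (block_disjoint disjEb) => i; exact: finset.subsetDl.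
Qed.

(** Stated for subsets of a singleton because the one-point blocks used below,
[E :&: [set i]] for all i in T, are empty when i is outside E. *)
Lemma indep_distr1 E x i : E \subset [set i]%SET -> cube E x ->
  decomposition E x (indep_distr E x).
Proof.
rewrite finset.subset1 => /orP[] /eqP -> x01.
  have /andP[x0 x1] := x01 i (finset.set11 i).
  have w0 : indep_distr [set i]%SET x finset.set0 = 1 - x i.
    by rewrite /indep_distr finset.setD0 finset.big_set0 finset.big_set1 mul1r.
  have w1 : indep_distr [set i]%SET x [set i]%SET = x i.
    by rewrite /indep_distr finset.setDv finset.big_set0 finset.big_set1 mulr1.
  have i0 : finset.set0 != [set i]%SET by rewrite eq_sym -card_gt0 cards1.
  split=> [j||S].
  - rewrite inE => /eqP ->; rewrite (big_pred1 [set i]%SET) ?w1// => S.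
    rewrite finset.subset1 /=; apply/andP/eqP => [[/orP[/eqP//|/eqP ->]]|->].
      by rewrite inE.
    by rewrite eqxx finset.set11.
  - rewrite (bigD1 [set i]%SET)//= (big_pred1 finset.set0) => [|S].
      by rewrite w0 w1 addrC subrK.
    rewrite finset.subset1 /=; have [->|S0] := eqVneq S finset.set0.
      by rewrite i0 orbT.
    by rewrite orbF andbN.
  - by rewrite finset.subset1 => /orP[] /eqP ->; rewrite ?w0 ?w1 ?subr_ge0.
have w0 : indep_distr finset.set0 x finset.set0 = 1.
  by rewrite /indep_distr finset.setD0 !finset.big_set0 mulr1.
split=> [j||S]; first by rewrite inE.
  by rewrite (big_pred1 finset.set0) => [//|S]; rewrite finset.subset0.
by rewrite finset.subset0 => /eqP ->; rewrite w0 ler01.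
Qed.

(** The independent distribution is the product of its one-point blocks, on each
of which the conditions are immediate. *)
Lemma indep_decomposition E x : cube E x -> decomposition E x (indep_distr E x).
Proof.
move=> x01; pose Eb i := E :&: [set i].
have disjEb i j : i != j -> Eb i :&: Eb j = finset.set0.
  move=> ij; apply/finset.setP => z; rewrite !inE.
  by apply/negP => /andP[/andP[_ /eqP ->] /andP[_]]; apply/negP.
have coverE : E = (\bigcup_i Eb i)%SET.
  apply/finset.setP => z; apply/idP/finset.bigcupP => [zE|[i _]].
    by exists z => //; rewrite !inE zE eqxx.
  by rewrite inE => /andP[].
have : decomposition E x (product_distr Eb (fun i => indep_distr (Eb i) x)).
  apply: product_decomposition => // i; apply: (@indep_distr1 _ _ i).
    exact: finset.subsetIr.
  by move=> j; rewrite inE => /andP[jE _]; exact: x01.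
have eqw S : S \subset E -> indep_distr E x S =
    product_distr Eb (fun i => indep_distr (Eb i) x) S.
  exact: indep_distr_blocks.
move=> [dx d1 d0]; split=> [i iE||S SE].
- by rewrite -(dx i iE); apply: eq_bigr => S /andP[SE _]; exact: eqw.
- by rewrite -d1; apply: eq_bigr => S; exact: eqw.
- by rewrite eqw// d0.
Qed.

End Independent.

(** * Additivity of the two extensions *)

Section Additivity.
Variables (R : realType) (T I : finType) (Eb : I -> {set T}) (E : {set T}).
Hypothesis disjEb : forall i j, i != j -> Eb i :&: Eb j = finset.set0.
Hypothesis coverE : E = (\bigcup_i Eb i)%SET.
Variables (f : {set T} -> R) (fb : I -> {set T} -> R).
Hypothesis fE : forall S : {set T}, S \subset E ->
  f S = \sum_i fb i (S :&: Eb i).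
Implicit Types (x : T -> R) (l : {set T} -> R).

Lemma cube_block x i : cube E x -> cube (Eb i) x.
Proof.
by move=> x01 z zi; apply: x01; exact: (fintype.subsetP (block_sub coverE i)).
Qed.

Lemma decomposition_value_blocks l :
  decomposition_value E f l =
  \sum_i decomposition_value (Eb i) (fb i) (marginal E (Eb i) l).
Proof.
under [RHS]eq_bigr do rewrite -marginal_sum.
by rewrite exchange_big; apply: eq_bigr => S SE; rewrite fE// mulr_sumr.
Qed.

Lemma decomposition_value_product (lb : I -> {set T} -> R) :
  (forall i, \sum_(S : {set T} | S \subset Eb i) lb i S = 1) ->
  decomposition_value E f (product_distr Eb lb) =
  \sum_i decomposition_value (Eb i) (fb i) (lb i).
Proof.
move=> lb1; rewrite decomposition_value_blocks; apply: eq_bigr => i _.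
by apply: eq_bigr => B BE; rewrite (marginal_product disjEb coverE).
Qed.

Lemma multilinear_ext_blocks x : cube E x ->
  multilinear_ext E f x = \sum_i multilinear_ext (Eb i) (fb i) x.
Proof.
move=> x01; under [RHS]eq_bigr do rewrite multilinear_extE.
rewrite -decomposition_value_product => [|i]; last first.
  by have [] := indep_decomposition (@cube_block x i x01).
rewrite multilinear_extE; apply: eq_bigr => S SE.
by rewrite (indep_distr_blocks x disjEb coverE).
Qed.

Lemma concave_ext_blocks x : cube E x ->
  concave_ext E f x = \sum_i concave_ext (Eb i) (fb i) x.
Proof.
move=> x01; apply/eqP; rewrite eq_le; apply/andP; split.
  have [[l lx ->] _] := concave_ext_max f x01.
  rewrite decomposition_value_blocks; apply: ler_sum => i _.
  have [_] := concave_ext_max (fb i) (@cube_block x i x01); apply.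
  exact: marginal_decomposition (block_sub coverE i) lx.
have /choice[lb lbP] i : exists l, decomposition (Eb i) x l /\
    concave_ext (Eb i) (fb i) x = decomposition_value (Eb i) (fb i) l.
  have [[l lx lE] _] := concave_ext_max (fb i) (@cube_block x i x01).
  by exists l.
under eq_bigr do rewrite (lbP _).2.
rewrite -decomposition_value_product => [|i]; last by have [[]] := lbP i.
have [_] := concave_ext_max f x01; apply.
by apply: product_decomposition => // i; have [] := lbP i.
Qed.

End Additivity.

(** * Correlation gaps *)

Section Gap.
Variables (R : realType) (T : finType).
Implicit Types (E : {set T}) (f : {set T} -> R) (x : T -> R).

Lemma multilinear_ext_ge0 E f x : (forall S, 0 <= f S) -> cube E x ->
  0 <= multilinear_ext E f x.
Proof.
move=> f0 x01; rewrite multilinear_extE.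
exact: decomposition_value_ge0 f0 (indep_decomposition x01).
Qed.

Lemma multilinear_ext_le_concave E f x : cube E x ->
  multilinear_ext E f x <= concave_ext E f x.
Proof.
move=> x01; rewrite multilinear_extE; have [_] := concave_ext_max f x01; apply.
exact: indep_decomposition.
Qed.

Lemma gap_ratio_ge0 E f x : (forall S, 0 <= f S) -> cube E x ->
  0 <= gap_ratio E f x.
Proof.
move=> f0 x01; rewrite /gap_ratio; case: ifP => // _.
have F0 := multilinear_ext_ge0 f0 x01.
by rewrite divr_ge0// (le_trans F0)// multilinear_ext_le_concave.
Qed.

Lemma correlation_gap_le E f x : (forall S, 0 <= f S) -> cube E x ->
  correlation_gap E f <= gap_ratio E f x.
Proof.
move=> f0 x01; apply: ge_inf; last by exists x.
by exists 0 => _ [y y01 <-]; exact: gap_ratio_ge0.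
Qed.

Lemma cube0 E x : (forall i, i \in E -> x i = 0) -> cube E x.
Proof. by move=> x0 i iE; rewrite x0// lexx ler01. Qed.

(** At the origin a decomposition can only charge the empty set. *)
Lemma decomposition_value0 E f x l :
  f finset.set0 = 0 -> (forall i, i \in E -> x i = 0) -> decomposition E x l ->
  decomposition_value E f l = 0.
Proof.
move=> f0 x0 [lx _ l0]; apply: big1 => S SE.
have [->|/finset.set0Pn[i iS]] := eqVneq S finset.set0.
  by rewrite f0 mulr0.
have iE := fintype.subsetP SE i iS.
have /eqP := lx i iE; rewrite x0// psumr_eq0 => [/allP/(_ S)|S' /andP[S'E _]].
  by rewrite mem_index_enum SE iS => /(_ isT)/eqP ->; rewrite mul0r.
exact: l0.
Qed.

Lemma multilinear_ext0 E f x :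
  f finset.set0 = 0 -> (forall i, i \in E -> x i = 0) ->
  multilinear_ext E f x = 0.
Proof.
move=> f0 x0; rewrite multilinear_extE.
apply: decomposition_value0 (x0) _ => //.
by apply: indep_decomposition; exact: cube0.
Qed.

Lemma concave_ext0 E f x :
  f finset.set0 = 0 -> (forall i, i \in E -> x i = 0) -> concave_ext E f x = 0.
Proof.
move=> f0 x0; have [[l lx ->] _] := concave_ext_max f (cube0 x0).
exact: decomposition_value0 lx.
Qed.

(** The origin gives the ratio 0/0, which is 1 by convention. *)
Lemma correlation_gap_le1 E f : (forall S, 0 <= f S) -> f finset.set0 = 0 ->
  correlation_gap E f <= 1.
Proof.
move=> f_ge0 f0; have x0 (i : T) : i \in E -> (0 : R) = 0 by [].
apply: (le_trans (correlation_gap_le f_ge0 (cube0 x0))).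
by rewrite /gap_ratio multilinear_ext0// concave_ext0// eqxx.
Qed.

(** The ratio bound cleared of its denominator. This form also holds where fhat
vanishes, so that it can be summed over blocks, some of which may be
degenerate. *)
Lemma correlation_gap_mul E f x : (forall S, 0 <= f S) -> cube E x ->
  correlation_gap E f * concave_ext E f x <= multilinear_ext E f x.
Proof.
move=> f0 x01; have F0 := multilinear_ext_ge0 f0 x01.
have Ff := multilinear_ext_le_concave f x01.
have [fh0|fh0] := eqVneq (concave_ext E f x) 0; first by rewrite fh0 mulr0.
have fh_gt0 : 0 < concave_ext E f x by rewrite lt_def fh0 (le_trans F0 Ff).
rewrite -ler_pdivlMr//; have := correlation_gap_le f0 x01.
by rewrite /gap_ratio (negPf fh0) andbF.
Qed.

Lemma decomposition_congr E x y l : {in E, x =1 y} ->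
  decomposition E x l -> decomposition E y l.
Proof. by move=> xy [lx l1 l0]; split=> // i iE; rewrite lx// xy. Qed.

Lemma concave_ext_congr E f x y : {in E, x =1 y} ->
  concave_ext E f x = concave_ext E f y.
Proof.
move=> xy; congr (sup (image _ _)); apply/seteqP; split => l.
  exact: decomposition_congr.
by apply: decomposition_congr => i iE; rewrite xy.
Qed.

Lemma multilinear_ext_congr E f x y : {in E, x =1 y} ->
  multilinear_ext E f x = multilinear_ext E f y.
Proof.
move=> xy; apply: eq_bigr => S SE; congr (_ * _ * _); apply: eq_bigr => i.
  by move=> /(fintype.subsetP SE) /xy ->.
by rewrite inE => /andP[_ /xy ->].
Qed.

End Gap.

Section GapBlocks.
Variables (R : realType) (T I : finType) (Eb : I -> {set T}) (E : {set T}).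
Hypothesis disjEb : forall i j, i != j -> Eb i :&: Eb j = finset.set0.
Hypothesis coverE : E = (\bigcup_i Eb i)%SET.
Variables (f : {set T} -> R) (fb : I -> {set T} -> R).
Hypothesis fE : forall S : {set T}, S \subset E ->
  f S = \sum_i fb i (S :&: Eb i).
Hypothesis f_ge0 : forall S, 0 <= f S.
Hypothesis fb_ge0 : forall i S, 0 <= fb i S.
Hypothesis fb0 : forall i, fb i finset.set0 = 0.

(** Extend a point of a block by 0: the other blocks then contribute nothing to
either extension. *)
Lemma correlation_gap_blocks_le i :
  correlation_gap E f <= correlation_gap (Eb i) (fb i).
Proof.
apply: lb_le_inf; first by exists (gap_ratio (Eb i) (fb i) (fun=> 0)), (fun=> 0)
  => //; exact: cube0.
move=> _ [x x01 <-]; pose y j := if j \in Eb i then x j else 0.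
have yx : {in Eb i, y =1 x} by move=> j ji; rewrite /y ji.
have y0 j : j != i -> forall z, z \in Eb j -> y z = 0.
  move=> ji z zj; rewrite /y; case: ifP => // zi.
  by have /finset.setP/(_ z) := disjEb ji; rewrite !inE zi zj.
have y01 : cube E y.
  by move=> j _; rewrite /y; case: ifP => [/x01//|_]; rewrite lexx ler01.
apply: (le_trans (correlation_gap_le f_ge0 y01)).
rewrite /gap_ratio (multilinear_ext_blocks disjEb coverE fE y01).
rewrite (concave_ext_blocks disjEb coverE fE y01).
have -> : \sum_j multilinear_ext (Eb j) (fb j) y =
    multilinear_ext (Eb i) (fb i) x.
  rewrite (bigD1 i)//= big1 ?addr0; first exact: multilinear_ext_congr.
  by move=> j ji; rewrite multilinear_ext0//; exact: y0.
have -> : \sum_j concave_ext (Eb j) (fb j) y = concave_ext (Eb i) (fb i) x.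
  rewrite (bigD1 i)//= big1 ?addr0; first exact: concave_ext_congr.
  by move=> j ji; rewrite concave_ext0//; exact: y0.
by [].
Qed.

(** The inequalities F_i >= m fhat_i add up. The bound [m <= 1] covers the
points where the ratio is 0/0, read as 1. *)
Lemma correlation_gap_blocks_ge m : m <= 1 ->
  (forall i, m <= correlation_gap (Eb i) (fb i)) -> m <= correlation_gap E f.
Proof.
move=> m1 mgap; apply: lb_le_inf; first by exists (gap_ratio E f (fun=> 0)),
  (fun=> 0) => //; exact: cube0.
move=> _ [x x01 <-].
have F0 := multilinear_ext_ge0 f_ge0 x01.
have Ff := multilinear_ext_le_concave f x01.
rewrite /gap_ratio; case: ifPn => // Fneq0.
(* The fraction is not of the form F / 0, because 0 <= F <= fhat. *)
have fh_gt0 : 0 < concave_ext E f x.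
  rewrite lt_def (le_trans F0 Ff) andbT; apply: contra Fneq0 => /eqP fh0.
  by rewrite fh0 eqxx andbT eq_le F0 andbT -fh0.
rewrite ler_pdivlMr// (multilinear_ext_blocks disjEb coverE fE x01).
rewrite (concave_ext_blocks disjEb coverE fE x01) mulr_sumr.
apply: ler_sum => i _; have xi01 := cube_block coverE (i := i) x01.
apply: le_trans (correlation_gap_mul (fb_ge0 i) xi01).
apply: ler_wpM2r => //; apply: (le_trans (multilinear_ext_ge0 (fb_ge0 i) xi01)).
exact: multilinear_ext_le_concave.
Qed.

End GapBlocks.

(** * Direct sums of matroids *)

Section DirectSum.
Variables (T : finType) (k : nat) (M : matroid T) (Ms : 'I_k -> matroid T).
Implicit Types S J : {set T}.

Lemma rank_set0 (N : matroid T) : rank N finset.set0 = 0%N.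
Proof.
apply/eqP; rewrite -leqn0; apply/bigmax_leqP => J /andP[_].
by rewrite finset.subset0 => /eqP ->; rewrite cards0.
Qed.

Lemma leq_card_rank (N : matroid T) J S :
  J \in indep N -> J \subset S -> (#|J| <= rank N S)%N.
Proof. by move=> JN JS; apply: (leq_bigmax_cond J); rewrite JN. Qed.

Lemma rank_attained (N : matroid T) S :
  exists J, [/\ J \in indep N, J \subset S & #|J| = rank N S].
Proof.
have [|J /andP[JN JS] JE] := @eq_bigmax_cond _
    [pred J : {set T} | (J \in indep N) && (J \subset S)] (fun J => #|J|).
  by apply/card_gt0P; exists finset.set0; rewrite inE indep_set0 finset.sub0set.
by exists J; split=> //; rewrite -JE.
Qed.

(** Independent sets are chosen separately in the summands, and sizes add up
because the ground sets are disjoint. *)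
Lemma rank_direct_sum S : is_direct_sum M Ms ->
  rank M S = (\sum_i rank (Ms i) (S :&: ground (Ms i)))%N.
Proof.
move=> [disjM _ indepM].
have cardU (J : 'I_k -> {set T}) : (forall i, J i \in indep (Ms i)) ->
    #|(\bigcup_i J i)%SET| = (\sum_i #|J i|)%N.
  move=> JM; rewrite -sum1_card partition_disjoint_bigcup/=.
    by apply: eq_bigr => i _; rewrite sum1_card.
  by apply: (block_disjoint disjM) => i; exact: indep_ground.
apply/eqP; rewrite eqn_leq; apply/andP; split.
  apply/bigmax_leqP => J /andP[/indepM[Jb JbM ->] /finset.bigcupsP JS].
  rewrite cardU//; apply: leq_sum => i _; apply: leq_card_rank => //.
  by rewrite finset.subsetI JS//= indep_ground.
have /choice[J JP] i := rank_attained (Ms i) (S :&: ground (Ms i)).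
have JM i : J i \in indep (Ms i) by have [] := JP i.
rewrite (eq_bigr (fun i => #|J i|)) => [|i _]; last by have [] := JP i.
rewrite -cardU//; apply: leq_card_rank; first by apply/indepM; exists J.
apply/finset.bigcupsP => i _; have [_ + _] := JP i.
by rewrite finset.subsetI => /andP[].
Qed.

End DirectSum.

Theorem proposition1p4 (R : realType) (T : finType) (k : nat)
    (M : matroid T) (Ms : 'I_k.+1 -> matroid T) :
  is_direct_sum M Ms ->
  matroid_gap R M =
    \big[Order.min/matroid_gap R (Ms ord0)]_(i < k.+1) matroid_gap R (Ms i).
Proof.
move=> MMs; have [disjM coverM _] := MMs.
have rankM (S : {set T}) : S \subset ground M -> (rank M S)%:R =
    \sum_i (rank (Ms i) (S :&: ground (Ms i)))%:R :> R.
  by move=> _; rewrite (rank_direct_sum S MMs) natr_sum.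
have rank0 (N : matroid T) : (rank N finset.set0)%:R = 0 :> R.
  by rewrite rank_set0.
have gap_le i : matroid_gap R M <= matroid_gap R (Ms i).
  apply: (@correlation_gap_blocks_le R T 'I_k.+1 _ _ disjM coverM _
    (fun i S => (rank (Ms i) S)%:R)) => *; rewrite ?ler0n//; exact: rankM.
apply/eqP; rewrite eq_le; apply/andP; split; first by apply: le_bigmin.
apply: (@correlation_gap_blocks_ge R T 'I_k.+1 _ _ disjM coverM _
  (fun i S => (rank (Ms i) S)%:R)) => [|*|*||i]; first exact: rankM.
- by rewrite ler0n.
- by rewrite ler0n.
- apply: (le_trans (bigmin_le_id _ _ _ _)).
  by apply: correlation_gap_le1 => *; rewrite ?ler0n.
- exact: bigmin_le.
Qed.
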